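(* Let $W_n=C_n+v$ denote the wheel on $n+1\ge 4$ vertices (a cycle $C_n$ together with a centre vertex $v$ adjacent to all vertices of $C_n$). (a) $crx_1(W_n)=3$ for $n\ge 3$. (b) $crx_2(W_3)=3$, and $crx_2(W_n)=\lceil n/2\rceil+2$ for $n\ge 4$. (c) $crx_3(W_n)=n$ if $3\le n\le 7$; $crx_3(W_n)=n-1$ if $8\le n\le 11$; and $crx_3(W_n)=n-2$ if $n\ge 12$. (d) For $k\ge 4$ and $n+1\ge k$: $crx_k(W_n)=n+1$ if $n<2k$, and $crx_k(W_n)=n$ if $n\ge 2k$.
   Context: An edge-coloured cycle is rainbow if its edges have distinct colours. For a graph $G$ in which any $k$ vertices lie on a common cycle, $crx_k(G)$ is the minimum number of colours in an edge-colouring of $G$ such that every set of $k$ vertices of $G$ lies in some rainbow cycle. *)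

(* Defs.v *)
From mathcomp Require Import all_boot.
Set Implicit Arguments. Unset Strict Implicit. Unset Printing Implicit Defensive.

(* A simple graph: symmetric irreflexive relation e on a finType. *)

Definition is_graph_cycle (T : finType) (e : rel T) (s : seq T) : bool :=
  [&& 3 <= size s, uniq s & cycle e s].

Definition cycle_edges (T : finType) (s : seq T) : seq {set T} :=
  map (fun p => [set p.1; p.2]) (zip s (rot 1 s)).

(* An edge-colouring is a function on (unordered) vertex pairs; only its
   values on edges matter.  It uses at most m colours if every edge gets a
   colour in {0,..,m-1}. *)
Definition colouring_with (T : finType) (e : rel T) (m : nat)
  (c : {set T} -> nat) : Prop :=
  forall x y, e x y -> c [set x; y] < m.

Definition rainbow (T : finType) (c : {set T} -> nat) (s : seq T) : bool :=
  uniq (map c (cycle_edges s)).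

Definition k_rainbow_cycle_colouring (T : finType) (e : rel T) (k : nat)
  (c : {set T} -> nat) : Prop :=
  forall S : {set T}, #|S| = k ->
    exists s : seq T, [/\ is_graph_cycle e s, rainbow c s & S \subset [set x in s]].

Definition crx_is (T : finType) (e : rel T) (k m : nat) : Prop :=
  (exists c, colouring_with e m c /\ k_rainbow_cycle_colouring e k c) /\
  (forall m', m' < m -> ~ exists c, colouring_with e m' c /\ k_rainbow_cycle_colouring e k c).

(* The wheel W_n on vertex set 'I_(n+1): vertices 0..n-1 form the cycle C_n
   (i ~ i+1 mod n), vertex n is the centre adjacent to all others. *)
Definition wheel_adj (n : nat) : rel 'I_n.+1 :=
  fun x y => (x != y) &&
    [|| nat_of_ord x == n, nat_of_ord y == n,
        (x.+1 %% n == y) | (y.+1 %% n == x)].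
Arguments wheel_adj n : clear implicits.

(* Main.v *)
(* A cycle of the wheel is either the rim or consists of the hub and an arc of the
   rim; in the latter case it omits an open arc whose interior avoids the given
   vertex set.

   For [k = 3] a set of three rim vertices leaves three gaps, one of which must meet
   every pair of rim edges of the same colour.  Hence no colour occurs three times on
   the rim, any two such pairs interleave, and there are no three of them, which
   leaves at least [n - 2] colours; for small [n] the gaps can moreover be chosen too
   short for the two spokes to get colours of their own.

   For [k >= 4] and at most [n] colours the rim is rainbow and uses all colours, so
   the colour of a spoke is that of a rim edge, which has to be omitted together with
   the spoke's end.  The arcs that may be omitted are pierced by at most
   [max(3, n./2)] vertices, so that [k - 1] vertices and the hub lie on no rainbow
   cycle when [n < 2 * k].  The colourings for the upper bounds conversely come from
   omissible arcs with disjoint interiors. *)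
Require Import Defs.
From mathcomp Require Import all_boot zify.
Set Implicit Arguments. Unset Strict Implicit. Unset Printing Implicit Defensive.

(** * Injectivity and counting for sequences *)

Lemma uniq_map_injective (T U : eqType) (f : T -> U) (s : seq T) :
  uniq (map f s) -> {in s &, injective f}.
Proof.
elim: s => [|a s IHs] //= /andP[fa us] x y; rewrite !inE.
case/predU1P=> [->|xs] /predU1P[->|ys] // e.
- by rewrite e (map_f f ys) in fa.
- by rewrite -e (map_f f xs) in fa.
exact: IHs.
Qed.

Lemma size_le_bound (s : seq nat) m : uniq s -> {in s, forall x, x < m} -> size s <= m.
Proof.
move=> us sm; rewrite -(size_iota 0 m); apply: uniq_leq_size => // x /sm.
by rewrite mem_iota.
Qed.

Lemma last_iota x p : last x (iota x.+1 p) = x + p.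
Proof. by elim: p x => [|p IHp] x /=; rewrite ?addn0 // IHp addSnnS. Qed.

(** * Edges of cycles *)

(** A recursive counterpart of [cycle_edges], whose [zip] with a rotation does not split along
    concatenations. *)
Fixpoint path_edges (T : finType) (x : T) (s : seq T) : seq {set T} :=
  if s is y :: s' then [set x; y] :: path_edges y s' else [::].

Lemma cycle_edges_cons (T : finType) (x : T) s :
  cycle_edges (x :: s) = path_edges x (rcons s x).
Proof.
rewrite /cycle_edges rot1_cons.
suff gen z y : [seq [set p.1; p.2] | p <- zip (y :: s) (rcons s z)]
  = path_edges y (rcons s z) by exact: gen.
by elim: s y => [|a s IHs] y //=; rewrite IHs.
Qed.

Lemma path_edges_cat (T : finType) (x : T) s1 s2 :
  path_edges x (s1 ++ s2) = path_edges x s1 ++ path_edges (last x s1) s2.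
Proof. by elim: s1 x => [|y s1 IHs] x //=; rewrite IHs. Qed.

Lemma path_edges_rev (T : finType) (x : T) s :
  path_edges (last x s) (rev (belast x s)) = rev (path_edges x s).
Proof.
elim: s x => [|y s IHs] x //=.
rewrite !rev_cons -!cats1 path_edges_cat IHs /= setUC; congr (_ ++ [:: [set _; _]]).
by case: s {IHs} => [|z s] //=; rewrite rev_cons last_rcons.
Qed.

(** The two lists differ by a swap of two blocks of edges; being rainbow depends only on the
    multiset. *)
Lemma cycle_edges_catC (T : finType) (s1 s2 : seq T) :
  perm_eq (cycle_edges (s1 ++ s2)) (cycle_edges (s2 ++ s1)).
Proof.
case: s1 s2 => [|x s1] [|y s2] //=; rewrite ?cats0 //.
rewrite !cycle_edges_cons !rcons_cat !rcons_cons -!cat_rcons !path_edges_cat.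
by rewrite !last_rcons perm_catC.
Qed.

Lemma cycle_edges_rev (T : finType) (s : seq T) :
  perm_eq (cycle_edges (rev s)) (cycle_edges s).
Proof.
case: s => [|x s] //; rewrite rev_cons -cats1.
apply: perm_trans (cycle_edges_catC _ _) _; rewrite cat1s !cycle_edges_cons.
have := path_edges_rev x (rcons s x).
rewrite last_rcons belast_rcons rev_cons => ->.
by rewrite perm_rev.
Qed.

Definition rainbow_cycle (T : finType) (e : rel T) c (s : seq T) :=
  is_graph_cycle e s && rainbow c s.

Lemma rainbow_cycle_catC (T : finType) (e : rel T) c (s1 s2 : seq T) :
  rainbow_cycle e c (s1 ++ s2) = rainbow_cycle e c (s2 ++ s1).
Proof.
rewrite /rainbow_cycle /is_graph_cycle /rainbow -rot_size_cat rot_cycle rot_uniq.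
rewrite size_rot rot_size_cat.
by rewrite (perm_uniq (perm_map _ (cycle_edges_catC _ _))).
Qed.

Lemma rainbow_cycle_rev (T : finType) (e : rel T) c (s : seq T) :
  symmetric e -> rainbow_cycle e c (rev s) = rainbow_cycle e c s.
Proof.
move=> es; rewrite /rainbow_cycle /is_graph_cycle /rainbow size_rev rev_uniq rev_cycle.
rewrite (perm_uniq (perm_map _ (cycle_edges_rev _))).
by rewrite (eq_cycle (e' := e)) // => x y; rewrite /= es.
Qed.

Lemma size_cycle_edges (T : finType) (s : seq T) : size (cycle_edges s) = size s.
Proof. by rewrite size_map size_zip size_rot minnn. Qed.

Lemma path_edges_in (T : finType) (e : rel T) x s A :
  path e x s -> A \in path_edges x s -> exists2 p, e p.1 p.2 & A = [set p.1; p.2].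
Proof.
elim: s x => [|y s IHs] x //= /andP[exy pys]; rewrite inE => /predU1P[->|].
  by exists (x, y).
exact: IHs.
Qed.

(** A cycle has as many edges as vertices, and their colours are distinct. *)
Lemma size_rainbow_cycle (T : finType) (e : rel T) c m (s : seq T) :
  colouring_with e m c -> rainbow_cycle e c s -> size s <= m.
Proof.
move=> cm /andP[/and3P[_ _ es] rs].
rewrite -size_cycle_edges -(size_map c); apply: size_le_bound => // _ /mapP[A As ->].
case: s es As {rs} => [|x s] //; rewrite cycle_edges_cons => es /(path_edges_in es)[p ep ->].
exact: cm.
Qed.

(** * Cycles of the wheel *)

(** Indices are read modulo [n], so that an arc passing through vertex 0 is still an interval of
    naturals. *)
Definition rim n i : 'I_n.+1 := inord (i %% n).

Lemma val_rim n i : 0 < n -> rim n i = i %% n :> nat.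
Proof. by move=> n0; rewrite inordK // ltnS ltnW // ltn_mod. Qed.

Lemma rim_mod n i : rim n (i %% n) = rim n i.
Proof. by rewrite /rim modn_mod. Qed.

Lemma rim_eq n i j : 0 < n -> (rim n i == rim n j) = (i == j %[mod n]).
Proof. by move=> n0; rewrite -val_eqE /= !val_rim. Qed.

Lemma rim_neq_hub n i : 0 < n -> (rim n i == ord_max) = false.
Proof. by move=> n0; rewrite -val_eqE /= val_rim // ltn_eqF // ltn_mod. Qed.

Lemma hub_or_rim n (x : 'I_n.+1) : x = ord_max \/ exists2 i, i < n & x = rim n i.
Proof.
have [|xn] := eqVneq x ord_max; [by left | right].
have xn' : x < n by have := ltn_ord x; rewrite -val_eqE /= in xn; lia.
by exists x => //; apply: val_inj; rewrite /= val_rim ?modn_small //; lia.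
Qed.

Lemma wheel_adj_sym n : symmetric (wheel_adj n).
Proof.
move=> x y; rewrite /wheel_adj eq_sym; congr (_ && _).
by rewrite orbCA; do 2 congr (_ || _); rewrite orbC.
Qed.

Lemma wheel_adj_hub n i : 0 < n -> wheel_adj n ord_max (rim n i).
Proof. by move=> n0; rewrite /wheel_adj eq_sym rim_neq_hub //= eqxx. Qed.

Lemma wheel_adj_rim n i j : 1 < n ->
  wheel_adj n (rim n i) (rim n j) = (i.+1 == j %[mod n]) || (j.+1 == i %[mod n]).
Proof.
move=> n1; have n0 : 0 < n by lia.
rewrite /wheel_adj rim_eq // !val_rim // -!(addn1 (_ %% _)) !modnDml !addn1.
rewrite !(ltn_eqF (ltn_pmod _ n0)) /=.
case: eqP => //= e; apply/esym/negbTE; rewrite -!(addn1 i) -!(addn1 j).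
have nS k : (k + 1 == k %[mod n]) = false.
  by rewrite -{2}(addn0 k) eqn_modDl !modn_small.
by rewrite -e nS e nS.
Qed.

Lemma rim_adj n i : 1 < n -> wheel_adj n (rim n i) (rim n i.+1).
Proof. by move=> n1; rewrite wheel_adj_rim // eqxx. Qed.

Lemma path_rim n x p : 1 < n -> path (wheel_adj n) (rim n x) (map (rim n) (iota x.+1 p)).
Proof. by move=> n1; elim: p x => [|p IHp] x //=; rewrite rim_adj ?IHp. Qed.

Definition rim_colour n (c : {set 'I_n.+1} -> nat) i := c [set rim n i; rim n i.+1].
Definition spoke_colour n (c : {set 'I_n.+1} -> nat) i := c [set rim n i; ord_max].

Lemma rim_colour_mod n c i : rim_colour c (i %% n) = rim_colour (n := n) c i.
Proof.
rewrite /rim_colour rim_mod; congr (c [set _; _]).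
by congr inord; rewrite -(addn1 (i %% n)) modnDml addn1.
Qed.

Lemma spoke_colour_mod n c i : spoke_colour c (i %% n) = spoke_colour (n := n) c i.
Proof. by rewrite /spoke_colour rim_mod. Qed.

Lemma path_edges_rim n x p (c : {set 'I_n.+1} -> nat) :
  map c (path_edges (rim n x) (map (rim n) (iota x.+1 p))) = map (rim_colour c) (iota x p).
Proof. by elim: p x => [|p IHp] x //=; rewrite IHp. Qed.

(** Normal form of a cycle through the hub: two spokes and [p] rim edges, hence [p + 1] rim
    vertices. *)
Definition hub_path n x p : seq 'I_n.+1 := ord_max :: map (rim n) (iota x p.+1).

Lemma rainbow_hub_path n x p (c : {set 'I_n.+1} -> nat) :
  rainbow c (hub_path n x p) =
  uniq (spoke_colour c x :: spoke_colour c (x + p) :: map (rim_colour c) (iota x p)).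
Proof.
rewrite /rainbow /hub_path cycle_edges_cons /= -cats1 path_edges_cat map_cat.
rewrite path_edges_rim /= setUC -/(spoke_colour c x) cats1.
by rewrite (last_map (rim n)) last_iota mem_rcons rcons_uniq.
Qed.

Lemma uniq_rim_iota n x p : 0 < n -> uniq (map (rim n) (iota x p)) = (p <= n).
Proof.
move=> n0; apply/idP/idP => [u|pn].
  rewrite leqNgt; apply/negP => np.
  suff : x = x + n by lia.
  apply: (uniq_map_injective u); rewrite ?mem_iota; [lia | lia |].
  by apply/eqP; rewrite rim_eq // modnDr.
rewrite map_inj_in_uniq ?iota_uniq // => i j; rewrite !mem_iota => ip jp /eqP.
rewrite rim_eq // => e; wlog ij : i j ip jp e / i <= j.
  by move=> H; case: (leqP i j) => ij; [apply: H | apply/esym; apply: H; rewrite // 1?eq_sym // ltnW].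
move: e; rewrite eq_sym eqn_mod_dvd // => /dvdnP[q]; case: q => [|q]; first lia.
by rewrite mulSn; nia.
Qed.

Lemma hub_notin_rim n s : 0 < n -> ord_max \notin map (rim n) s.
Proof. by move=> n0; apply/mapP=> -[i _ /esym/eqP]; rewrite rim_neq_hub. Qed.

Lemma hub_path_cycle n x p : 1 < n -> 0 < p < n -> is_graph_cycle (wheel_adj n) (hub_path n x p).
Proof.
move=> n1 /andP[p0 pn]; have n0 : 0 < n by lia.
rewrite /is_graph_cycle /hub_path [uniq _]cons_uniq uniq_rim_iota // pn andbT.
rewrite hub_notin_rim //= size_map size_iota !ltnS p0 /=.
rewrite wheel_adj_hub // rcons_path path_rim //= (last_map (rim n)).
by rewrite wheel_adj_sym wheel_adj_hub.
Qed.

(* Two neighbours of a rim vertex are its predecessor and its successor, so a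
   path in the rim that does not turn back runs in a fixed direction. *)
Lemma rim_path_shape n x s : 1 < n -> path (wheel_adj n) x s -> uniq (x :: s) ->
  ord_max \notin x :: s -> exists y,
  let t := map (rim n) (iota y (size s).+1) in x :: s = t \/ x :: s = rev t.
Proof.
move=> n1; have n0 : 0 < n by lia.
elim: s x => [|x' s IHs] x.
  move=> _ _; rewrite inE eq_sym; case: (hub_or_rim x) => [->|[i _ ->]].
    by rewrite eqxx.
  by exists i; left.
rewrite [path _ _ _]/= [uniq _]/= inE => /andP[xx' px's] /andP[xs us].
rewrite inE negb_or => /andP[hx hs]; have [y] := IHs _ px's us hs.
have [i _ ex] : exists2 i, i < n & x = rim n i.
  by case: (hub_or_rim x) => // e; rewrite e eqxx in hx.
have rimp z : rim n (z + n) = rim n z by rewrite -[LHS]rim_mod modnDr rim_mod.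
have rimpm z p : map (rim n) (iota (z + n) p) = map (rim n) (iota z p).
  by rewrite addnC iotaDl -map_comp; apply: eq_map => j /=; rewrite addnC rimp.
(* Adding [n] first keeps the predecessor of index 0 from being truncated. *)
have nei z : wheel_adj n x (rim n z) -> x = rim n z.+1 \/ x = rim n (z + n).-1.
  rewrite ex wheel_adj_rim // => /orP[] e; [right | left]; last first.
    by apply/eqP; rewrite eq_sym rim_eq.
  apply/eqP; rewrite rim_eq // -(eqn_modDr 1) !addn1 prednK ?modnDr //; lia.
have revS z p : rev (map (rim n) (iota z p.+1)) = rim n (z + p) :: rev (map (rim n) (iota z p)).
  by rewrite -(addn1 p) iotaD map_cat rev_cat.
rewrite [size (_ :: _)]/=.
have fwd z : x' :: s = map (rim n) (iota z (size s).+1) -> x = rim n (z + n).-1 ->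
    x :: x' :: s = map (rim n) (iota (z + n).-1 (size s).+2).
  have ew : (z + n).-1.+1 = z + n by lia.
  by move: (_.-1) ew => w ew -> ->; rewrite -(rimpm z) -ew.
have bwd z : x' :: s = rev (map (rim n) (iota z (size s).+1)) ->
    x = rim n (z + (size s).+1) ->
    x :: x' :: s = rev (map (rim n) (iota z (size s).+2)).
  by move=> -> ->; rewrite [RHS]revS.
case=> exs.
- have e : x' = rim n y by case: exs.
  rewrite e in xx'; case: (nei _ xx') => e1; last by exists (y + n).-1; left; exact: fwd.
  (* A longer path would turn back here: [x] would equal the vertex after [x']. *)
  case: s exs us xs {IHs px's hs} fwd bwd => [|x'' s] exs us xs fwd bwd.
    by exists y; right; apply: bwd; rewrite ?addn1.
  case: exs => _ e2 _; rewrite e1 e2 !inE eqxx orbT in xs; done.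
- have e : x' = rim n (y + size s).
    by move: exs; rewrite revS; case.
  rewrite e in xx'; case: (nei _ xx') => e1.
    by exists y; right; apply: bwd; rewrite ?addnS.
  case: s exs e us xs {IHs px's hs xx'} e1 fwd bwd => [|x'' s] exs e us xs e1 fwd bwd.
    by exists (y + n).-1; left; apply: fwd; rewrite // e1 addn0.
  move: exs; rewrite [size _]/= !revS => -[_ e2 _].
  suff exx : x = x'' by rewrite exx !inE eqxx orbT in xs.
  by rewrite e1 e2 -(rimp (y + size s)) /=; congr (rim n _); lia.
Qed.

Lemma rim_iota_mod n x p : map (rim n) (iota (x %% n) p) = map (rim n) (iota x p).
Proof.
rewrite -(addn0 (x %% n)) -{2}(addn0 x) !iotaDl -!map_comp; apply: eq_map => i /=.
by rewrite /rim modnDml.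
Qed.

(** With the hub rotated to the front, the rest is a path in the rim. Without the hub, the whole
    cycle is a rim path with adjacent ends, hence the full rim. Only the vertex set is compared with
    [hub_path], since the cycle may run backwards. *)
Lemma rainbow_cycle_shape n c s : 2 < n -> rainbow_cycle (wheel_adj n) c s ->
  (ord_max \notin s /\ {in gtn n &, injective (rim_colour (n := n) c)}) \/
  exists x p, [/\ x < n, 0 < p < n, rainbow_cycle (wheel_adj n) c (hub_path n x p)
    & s =i hub_path n x p].
Proof.
move=> n2 rs; have [n1 n0] : 1 < n /\ 0 < n by lia.
have symW := @wheel_adj_sym n.
have [hs|hs] := boolP (ord_max \in s); [right | left; split=> //].
  have [i w ew] := rot_to hs.
  have rw : rainbow_cycle (wheel_adj n) c (ord_max :: w).
    by rewrite -ew /rot rainbow_cycle_catC cat_take_drop.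
  have mw : s =i ord_max :: w by move=> z; rewrite -ew mem_rot.
  case: w rw mw {ew} => [|a w] rw mw; first by case/andP: rw => /and3P[].
  have /andP[/and3P[sz uw cw] _] := rw.
  have [||| y] := @rim_path_shape n a w n1.
  - by move: cw; rewrite /= rcons_path => /and3P[].
  - by case/andP: uw.
  - by case/andP: uw.
  rewrite /= -map_cons -/(iota y (size w).+1) -rim_iota_mod => ew.
  have p0 : 0 < size w < n.
    move: sz uw; rewrite cons_uniq /= !ltnS => -> /=.
    case/andP=> _; rewrite -/(uniq (a :: w)); case: ew => ->; 
      by rewrite ?rev_uniq uniq_rim_iota.
  exists (y %% n), (size w); rewrite ltn_mod n0; case: ew => ew; split=> //.
  - by rewrite /hub_path -ew.
  - by rewrite /hub_path -ew.
  - by rewrite /hub_path -cat1s rainbow_cycle_catC -rainbow_cycle_rev // rev_cat -ew.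
  - by move=> z; rewrite mw /hub_path ew !inE mem_rev.
wlog [y ey] : s rs hs / exists y, s = map (rim n) (iota y (size s)).
  move=> H; case: s rs hs H => [|a w] rs hs H; first by case/andP: rs => /and3P[].
  have /andP[/and3P[sz uw cw] _] := rs.
  have [|//|//| y [ew|ew]] := @rim_path_shape n a w n1.
  - by move: cw; rewrite /= rcons_path => /andP[].
  - by apply: (H _ rs hs); exists y.
  - apply: (H (rev (a :: w))); rewrite ?rainbow_cycle_rev ?mem_rev //.
    by exists y; rewrite ew revK size_map size_iota.
rewrite -rim_iota_mod in ey; have yn : y %% n < n by rewrite ltn_mod.
move: (y %% n) yn ey => {}y yn ey.
have /andP[/and3P[sz us cs] rbs] := rs.
have sn : size s <= n by rewrite ey uniq_rim_iota // in us.
(* The closing edge joins [y + size s - 1] to [y]; as [size s] is at least 3, this forces a full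
   turn. *)
have esz : size s = n.
  case: (size s) sz sn ey => [|p] // sz sn ey.
  move: cs; rewrite ey /= rcons_path (last_map (rim n)) => /andP[_].
  rewrite last_iota.
  rewrite wheel_adj_rim // -addnS -(addn1 y) -{2}(addn0 y) !eqn_modDl mod0n.
  case/orP=> [/eqP|]; last by rewrite !modn_small; lia.
  by have [/modn_small->//|] := leqP p.+2 n; lia.
move: rbs; rewrite /rainbow ey esz.
rewrite (_ : iota y n = y :: iota y.+1 n.-1); last by rewrite -{1}(prednK n0).
rewrite map_cons cycle_edges_cons -cats1 path_edges_cat map_cat path_edges_rim.
rewrite (last_map (rim n)) last_iota.
rewrite (_ : map c (path_edges _ _) = map (rim_colour c) (iota (y + n.-1) 1)); last first.
  rewrite /= /rim_colour -addnS prednK //; congr [:: c [set _; _]].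
  by rewrite -[RHS]rim_mod modnDr rim_mod.
rewrite -map_cat -iotaD addn1 prednK // => /uniq_map_injective inj.
(* Each rim edge has an index in the window from [y] to [y + n - 1] that the cycle traverses. *)
have lift i : i < n -> exists2 i', i' \in iota y n & i' %% n = i.
  move=> ni; case: (leqP y i) => yi.
    by exists i; rewrite ?modn_small // mem_iota; lia.
  by exists (i + n); rewrite ?modnDr ?modn_small // mem_iota; lia.
move=> _ _ /lift[i ii <-] /lift[j jj <-]; rewrite !rim_colour_mod => e.
by rewrite (inj i j).
Qed.

(** * Rainbow arcs *)

(* The clockwise rim arc from [x] to [y] (both below [n], distinct): rim edge
   [i] joins [i] to [i + 1], so the arc has the edges [x], ..., [y - 1]. *)
Definition arc_edge x y i :=
  (x < y) && (x <= i < y) || (y < x) && ((x <= i) || (i < y)).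
Definition arc_vertex x y i :=
  (x < y) && (x <= i <= y) || (y < x) && ((x <= i) || (i <= y)).
(** The hub cycle over the arc has two spokes besides the edges of the arc, and [m] colours must
    suffice for all of them. *)
Definition arc_short n m x y :=
  (x < y) && (y + 2 <= x + m) || (y < x) && (y + n + 2 <= x + m).

(** The condition for the hub cycle over the arc to be rainbow. The functions [r] and [s] are
    arbitrary, so that it serves both given colourings and explicit tables. *)
Definition rainbow_arc n (r s : nat -> nat) x y : Prop :=
  [/\ s x <> s y,
      forall i, i < n -> arc_edge x y i -> r i <> s x /\ r i <> s y
    & forall i j, i < n -> j < n -> arc_edge x y i -> arc_edge x y j ->
        r i = r j -> i = j].

(** Replaces a remainder by a case distinction that linear arithmetic can handle. *)
Lemma modn_wrap n a : a < 2 * n -> a %% n = if a < n then a else a - n.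
Proof.
move=> an; case: ltnP => na; first by rewrite modn_small.
by rewrite -{1}(subnK na) modnDr modn_small //; lia.
Qed.

Lemma arc_end n x p : x < n -> 0 < p < n ->
  exists y, [/\ y = (x + p) %% n, y < n & x + p = y /\ x < y \/ x + p = y + n /\ y < x].
Proof.
move=> xn pn; exists ((x + p) %% n); split=> //; first by rewrite ltn_mod; lia.
by rewrite modn_wrap; [case: ltnP; lia | lia].
Qed.

Lemma hub_path_arc n c x y p : x < n -> y < n -> 0 < p < n ->
    x + p = y /\ x < y \/ x + p = y + n /\ y < x ->
  (rainbow c (hub_path n x p) <->
    rainbow_arc n (rim_colour c) (spoke_colour c) x y) /\
  (forall a, a < n -> (rim n a \in hub_path n x p) = arc_vertex x y a).
Proof.
move=> xn yn pn exy; have n0 : 0 < n by lia.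
have emod i : i < 2 * n -> i %% n = if i < n then i else i - n by exact: modn_wrap.
have ey : (x + p) %% n = y by rewrite emod; [case: ltnP|]; lia.
(* In the window of indices from [x] to [x + p - 1], an edge past the wrap appears as [i + n]. *)
have edge i : i < n -> arc_edge x y i = ((i \in iota x p) || (i + n \in iota x p)).
  by move=> ni; rewrite /arc_edge !mem_iota; lia.
split; last first.
  move=> a an; rewrite in_cons rim_neq_hub // orFb.
  apply/mapP/idP => [[i]|]; rewrite ?mem_iota /arc_vertex.
    move=> ip /eqP; rewrite rim_eq // (modn_small an) emod; last lia.
    by case: ltnP; lia.
  case: (boolP (x <= a <= x + p)) => ha aP.
    by exists a; rewrite // mem_iota; lia.
  exists (a + n); first by rewrite mem_iota; lia.
  by apply/eqP; rewrite rim_eq // modnDr.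
rewrite rainbow_hub_path -(spoke_colour_mod c (x + p)) ey.
set r := rim_colour c; set s := spoke_colour c.
have rmod i : r (i %% n) = r i by exact: rim_colour_mod.
have rD i : r (i + n) = r i by rewrite -rmod modnDr rmod.
rewrite !cons_uniq inE negb_or; split.
  case/and3P=> /andP[/eqP sxy nx] ny /uniq_map_injective inj.
  have ini i : i < n -> arc_edge x y i -> exists2 i', i' \in iota x p & r i' = r i /\ i' %% n = i.
    move=> ni; rewrite edge // => /orP[] h; [exists i | exists (i + n)] => //.
      by rewrite modn_small.
    by rewrite rD modnDr modn_small.
  split=> // [i ni /ini[]// i' h [<- _]|i j ni nj /ini[]// i' hi [<- <-] /ini[]// j' hj [<- <-]].
    by split=> e; [move: nx | move: ny]; rewrite -e map_f.
  by move/inj=> ->.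
case=> sxy spk inj.
have arcm i : i \in iota x p -> i %% n < n /\ arc_edge x y (i %% n).
  rewrite mem_iota => ip; split; first by rewrite ltn_mod.
  rewrite /arc_edge emod; last lia.
  by case: (ltnP i n); lia.
apply/and3P; split.
- apply/andP; split; first exact/eqP.
  by apply/mapP=> -[i /arcm[h1 h2]]; case: (spk _ h1 h2) => + _; rewrite rmod => /[swap] ->.
- by apply/mapP=> -[i /arcm[h1 h2]]; case: (spk _ h1 h2) => _; rewrite rmod => /[swap] ->.
rewrite map_inj_in_uniq ?iota_uniq // => i j ip jp e.
have [h1 h2] := arcm _ ip; have [h3 h4] := arcm _ jp.
have := inj _ _ h1 h3 h2 h4; rewrite !rmod => /(_ e).
by move: ip jp; rewrite !mem_iota => ip jp; rewrite !emod; [case: (ltnP i n); case: (ltnP j n); lia | lia | lia].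
Qed.

Definition in_rainbow_cycle n c (S : {set 'I_n.+1}) :=
  exists s, [/\ is_graph_cycle (wheel_adj n) s, rainbow c s & S \subset [set x in s]].

(** The rim has [n] edges and so needs [n] colours; any other rainbow cycle consists of the hub and
    an arc whose length is limited by [m]. *)
Lemma in_rainbow_cycle_shape n c m (S : {set 'I_n.+1}) : 2 < n ->
    colouring_with (wheel_adj n) m c -> in_rainbow_cycle c S ->
  [/\ n <= m, ord_max \notin S &
     forall i j, i < n -> j < n -> rim_colour c i = rim_colour c j -> i = j] \/
  exists x y, [/\ [/\ x < n, y < n & x != y],
    rainbow_arc n (rim_colour c) (spoke_colour c) x y, arc_short n m x y
    & forall a, a < n -> rim n a \in S -> arc_vertex x y a].
Proof.
move=> n2 cm [s [gs rs /subsetP Ss]].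
have n1 : 1 < n by lia.
have rcs : rainbow_cycle (wheel_adj n) c s by rewrite /rainbow_cycle gs.
case: (rainbow_cycle_shape n2 rcs) => [[hs inj]|[x [p [xn pn rx es]]]]; [left | right].
  split; last by move=> i j ni nj /inj; apply.
    rewrite -[n](size_iota 0) -(size_map (rim_colour c)); apply: size_le_bound.
      rewrite map_inj_in_uniq ?iota_uniq // => i j; rewrite !mem_iota => ni nj.
      by apply: inj; rewrite unfold_in /=; lia.
    by move=> _ /mapP[i _ ->]; apply: cm; rewrite rim_adj.
  by apply: contra hs => /Ss; rewrite inE.
have [y [_ yn exy]] := arc_end xn pn; exists x, y.
have [[rai _] mem] := hub_path_arc c xn yn pn exy.
split.
- by split=> //; lia.
- by apply: rai; case/andP: rx.
- have := size_rainbow_cycle cm rx; rewrite /= size_map size_iota /arc_short; lia.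
- by move=> a an /Ss; rewrite inE es mem.
Qed.

Lemma in_rainbow_cycle_arc n c (S : {set 'I_n.+1}) x y : 2 < n ->
    x < n -> y < n -> x != y ->
    rainbow_arc n (rim_colour c) (spoke_colour c) x y ->
    (forall a, a < n -> rim n a \in S -> arc_vertex x y a) ->
  in_rainbow_cycle c S.
Proof.
move=> n2 xn yn xy ra Sa.
have [p pn exy] : exists2 p, 0 < p < n & x + p = y /\ x < y \/ x + p = y + n /\ y < x.
  by case: (ltnP x y) => h; [exists (y - x) | exists (y + n - x)]; lia.
have [[_ rai] mem] := hub_path_arc c xn yn pn exy.
exists (hub_path n x p); split; first by apply: hub_path_cycle; lia.
  exact: rai.
apply/subsetP=> z zS; rewrite inE; case: (hub_or_rim z) => [->|[a an ez]].
  by rewrite inE eqxx.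
by rewrite ez mem // Sa // -ez.
Qed.

Lemma in_rainbow_cycle_rim n c (S : {set 'I_n.+1}) : 2 < n -> ord_max \notin S ->
    (forall i j, i < n -> j < n -> rim_colour c i = rim_colour c j -> i = j) ->
  in_rainbow_cycle c S.
Proof.
move=> n2 hS inj; have [n1 n0] : 1 < n /\ 0 < n by lia.
have em : n.-1.+1 = n by lia.
have ei : iota 0 n = 0 :: iota 1 n.-1 by rewrite -{1}em.
exists (map (rim n) (iota 0 n)); split.
- rewrite /is_graph_cycle size_map size_iota n2 uniq_rim_iota // leqnn /=.
  rewrite ei /= rcons_path path_rim //= (last_map (rim n)) last_iota add0n.
  by have := rim_adj n.-1 n1; rewrite em -(rim_mod n n) modnn.
- rewrite /rainbow ei map_cons cycle_edges_cons -cats1 path_edges_cat map_cat.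
  rewrite path_edges_rim (last_map (rim n)) last_iota add0n /=.
  have -> : c [set rim n n.-1; rim n 0] = rim_colour c n.-1.
    by rewrite /rim_colour em -(rim_mod n n) modnn.
  rewrite -[[:: rim_colour c n.-1]]/(map (rim_colour c) (iota (0 + n.-1) 1)).
  rewrite -map_cat -iotaD addn1 em map_inj_in_uniq ?iota_uniq // => i j.
  by rewrite !mem_iota => ni nj; apply: inj; lia.
apply/subsetP=> z zS; rewrite inE; case: (hub_or_rim z) => [ez|[a an ->]].
  by rewrite -ez zS in hS.
by rewrite map_f // mem_iota.
Qed.

(** A colouring takes vertex pairs, so the index of the edge is recovered by a search. The value 0
    on pairs that are not edges is a dummy. *)
Definition wheel_colouring n (r s : nat -> nat) (E : {set 'I_n.+1}) : nat :=
  if [pick i : 'I_n | E == [set rim n i; rim n i.+1]] is Some i then r i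
  else if [pick i : 'I_n | E == [set rim n i; ord_max]] is Some i then s i else 0.

(** For [n = 2] the two rim edges would be the same vertex pair. *)
Lemma rim_edge_inj n i j : 2 < n -> i < n -> j < n ->
  [set rim n i; rim n i.+1] = [set rim n j; rim n j.+1] -> i = j.
Proof.
move=> n2 ni nj /setP e; have n0 : 0 < n by lia.
have := e (rim n i); have := e (rim n i.+1).
rewrite !inE !rim_eq // !eqxx orbT /= !modn_wrap; [|lia..].
by move=> /esym + /esym; case: (ltnP i.+1); case: (ltnP j.+1); case: (ltnP i n); case: (ltnP j n); lia.
Qed.

Lemma spoke_edge_inj n i j : i < n -> j < n ->
  [set rim n i; ord_max] = [set rim n j; ord_max] -> i = j.
Proof.
move=> ni nj /setP/(_ (rim n i)); have n0 : 0 < n by lia.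
rewrite !inE eqxx !rim_neq_hub // !orbF rim_eq // !modn_small //.
by move/esym/eqP.
Qed.

Lemma wheel_colouring_rim n r s i : 2 < n -> i < n ->
  rim_colour (wheel_colouring (n := n) r s) i = r i.
Proof.
move=> n2 ni; rewrite /rim_colour /wheel_colouring; case: pickP => [j /eqP|/(_ (Ordinal ni))].
  by move/(rim_edge_inj n2 ni (ltn_ord j)) => ->.
by rewrite /= eqxx.
Qed.

Lemma wheel_colouring_spoke n r s i : 2 < n -> i < n ->
  spoke_colour (wheel_colouring (n := n) r s) i = s i.
Proof.
move=> n2 ni; have n0 : 0 < n by lia.
rewrite /spoke_colour /wheel_colouring; case: pickP => [j /eqP/setP/(_ ord_max)|_].
  by rewrite !inE eqxx orbT !(eq_sym ord_max) !rim_neq_hub.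
case: pickP => [j /eqP|/(_ (Ordinal ni))].
  by move/(spoke_edge_inj ni (ltn_ord j)) => ->.
by rewrite /= eqxx.
Qed.

Lemma wheel_colouring_bound n m r s : 2 < n ->
    (forall i, i < n -> r i < m) -> (forall i, i < n -> s i < m) ->
  colouring_with (wheel_adj n) m (wheel_colouring r s).
Proof.
move=> n2 rm sm; have [n1 n0] : 1 < n /\ 0 < n by lia.
have sp i : i < n -> wheel_colouring r s [set rim n i; ord_max] < m.
  by move=> ni; have := wheel_colouring_spoke r s n2 ni; rewrite /spoke_colour => ->; exact: sm.
have rp i : wheel_colouring r s [set rim n i; rim n i.+1] < m.
  rewrite -/(rim_colour _ i) -rim_colour_mod wheel_colouring_rim ?ltn_mod //.
  by apply: rm; rewrite ltn_mod.
move=> x y; case: (hub_or_rim x) => [->|[i ni ->]]; case: (hub_or_rim y) => [->|[j nj ->]].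
- by rewrite /wheel_adj eqxx.
- by rewrite setUC => _; exact: sp.
- by move=> _; exact: sp.
rewrite wheel_adj_rim // -!rim_eq // => /orP[/eqP<-|/eqP<-] //.
by rewrite setUC.
Qed.

(** Reduces every upper bound to tables of rim and spoke colours. The hub lies on all cycles of the
    second kind, so only the rim vertices of [S] have to be covered there. *)
Lemma wheel_colouring_exists n k m (r s : nat -> nat) : 2 < n ->
    (forall i, i < n -> r i < m) -> (forall i, i < n -> s i < m) ->
    (forall S : {set 'I_n.+1}, #|S| = k ->
      ord_max \notin S /\ (forall i j, i < n -> j < n -> r i = r j -> i = j) \/
      exists x y, [/\ x < n, y < n, x != y, rainbow_arc n r s x y
        & forall a, a < n -> rim n a \in S -> arc_vertex x y a]) ->
  exists c, colouring_with (wheel_adj n) m c /\ k_rainbow_cycle_colouring (wheel_adj n) k c.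
Proof.
move=> n2 rm sm H; exists (wheel_colouring r s).
split; first exact: wheel_colouring_bound.
move=> S /H[[hS inj]|[x [y [xn yn xy [sxy spk inj] Sa]]]].
  apply: in_rainbow_cycle_rim => // i j ni nj; rewrite !wheel_colouring_rim //.
  exact: inj.
apply: (in_rainbow_cycle_arc (x := x) (y := y)) => //; split.
- by rewrite !wheel_colouring_spoke.
- by move=> i ni ei; rewrite !wheel_colouring_spoke ?wheel_colouring_rim //; exact: spk.
by move=> i j ni nj ei ej; rewrite !wheel_colouring_rim //; exact: inj.
Qed.

(** * Lower bounds *)

(** Serves to enlarge a small obstruction to a set of exactly [k] vertices. *)
Lemma superset_of_card (T : finType) (B : {set T}) k :
  #|B| <= k <= #|T| -> exists2 S : {set T}, B \subset S & #|S| = k.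
Proof.
move=> /andP[]; rewrite leq_eqVlt => /predU1P[<- _|]; first by exists B.
elim: k => // k IHk; rewrite ltnS leq_eqVlt => Bk kT.
have [S BS Sk] : exists2 S : {set T}, B \subset S & #|S| = k.
  by case/predU1P: Bk => [<-|/IHk]; [exists B | apply; exact: ltnW].
have /card_gt0P[x] : 0 < #|~: S| by rewrite cardsCs setCK Sk subn_gt0.
rewrite inE => xS; exists (x |: S); last by rewrite cardsU1 xS Sk.
exact: subset_trans BS (subsetUr _ _).
Qed.

(** The common entry to the lower bounds: [A] lists at most [k] rim vertices to be covered, and
    setting [hub] excludes the rim as the covering cycle. *)
Lemma k_rainbow_cover n k m c (A : seq nat) (hub : bool) : 2 < n ->
    colouring_with (wheel_adj n) m c -> k_rainbow_cycle_colouring (wheel_adj n) k c ->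
    size A + hub <= k -> k <= n.+1 ->
  [/\ n <= m, ~~ hub &
     forall i j, i < n -> j < n -> rim_colour c i = rim_colour c j -> i = j] \/
  exists x y, [/\ [/\ x < n, y < n & x != y],
    rainbow_arc n (rim_colour c) (spoke_colour c) x y, arc_short n m x y
    & forall a, a < n -> a \in A -> arc_vertex x y a].
Proof.
move=> n2 cm kr Ak kn.
pose B := (if hub then [set ord_max] else set0) :|: [set x in map (rim n) A].
have /superset_of_card[S /subsetP BS] : #|B| <= k <= #|'I_n.+1|.
  rewrite card_ord kn andbT; apply: leq_trans Ak; rewrite addnC -(size_map (rim n)).
  apply: leq_trans (leq_card_setU _ _) _; apply: leq_add.
    by case: (hub); rewrite ?cards1 ?cards0.
  by rewrite cardsE card_size.
case/kr/(in_rainbow_cycle_shape n2 cm) => [[nm hS inj]|[x [y [xy ra sh cov]]]]; [left | right].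
  split=> //; apply: contra hS => h; apply: BS.
  by rewrite /B h !inE eqxx.
exists x, y; split=> // a an aA; apply: cov => //; apply: BS.
by rewrite !inE map_f // orbT.
Qed.

Lemma rim_colour_lt n m c i : 2 < n -> colouring_with (wheel_adj n) m c -> rim_colour c i < m.
Proof. by move=> n2; apply; apply: rim_adj; lia. Qed.

Lemma spoke_colour_lt n m c i : 2 < n -> colouring_with (wheel_adj n) m c -> spoke_colour c i < m.
Proof. by move=> n2; apply; rewrite wheel_adj_sym wheel_adj_hub //; lia. Qed.

Lemma pigeonhole (r : nat -> nat) (s : seq nat) m : uniq s -> m < size s ->
    {in s, forall i, r i < m} ->
  exists i j, [/\ i \in s, j \in s, i < j & r i = r j].
Proof.
move=> us ms rm.
have [H|/(uniqPn 0)[i [j [ij js e]]]] := boolP (uniq (map r s)).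
  suff : size s <= m by lia.
  by rewrite -(size_map r); apply: size_le_bound => // _ /mapP[i /rm ? ->].
rewrite size_map in js; have is' := ltn_trans ij js.
rewrite !(nth_map 0) // in e.
have ne : nth 0 s i != nth 0 s j by rewrite nth_uniq // ltn_eqF.
have [hi hj] := (mem_nth 0 is', mem_nth 0 js).
case: (ltngtP (nth 0 s i) (nth 0 s j)) ne => // h _.
  by exists (nth 0 s i), (nth 0 s j).
by exists (nth 0 s j), (nth 0 s i).
Qed.

(** * Lower bounds for one or two vertices *)

Lemma rainbow_colouring_ge3 n k m c : 2 < n -> k <= n.+1 ->
    colouring_with (wheel_adj n) m c -> k_rainbow_cycle_colouring (wheel_adj n) k c ->
  3 <= m.
Proof.
move=> n2 kn cm kr.
have [| |[? _ _]|[x [y [[xn yn xy] _ sh _]]]] // := k_rainbow_cover (A := [::]) (hub := false) n2 cm kr.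
  by lia.
by move: sh; rewrite /arc_short; lia.
Qed.

(** Both arcs between the antipodal vertices 0 and [h] have [h] edges, and two spokes are added; the
    rim itself has [2h >= h + 2] edges. *)
Lemma rainbow2_even_bound h m c : 2 <= h ->
    colouring_with (wheel_adj h.*2) m c -> k_rainbow_cycle_colouring (wheel_adj h.*2) 2 c ->
  h + 2 <= m.
Proof.
move=> h2 cm kr; have n2 : 2 < h.*2 by lia.
have [| |[? _ _]|[x [y [[xn yn xy] _ sh cov]]]] // :=
  k_rainbow_cover (A := [:: 0; h]) (hub := false) n2 cm kr; try lia.
have := cov 0; have := cov h; rewrite !inE !eqxx orbT.
by move: sh; rewrite /arc_short /arc_vertex; lia.
Qed.

(** With only [h + 2] colours, every window of [h] consecutive rim edges together with its two end
    spokes uses each colour once. This rigidity is incompatible with the repetition of a colour on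
    the rim. *)
Lemma rainbow2_odd_bound h m c : 2 <= h ->
    colouring_with (wheel_adj h.*2.+1) m c ->
    k_rainbow_cycle_colouring (wheel_adj h.*2.+1) 2 c ->
  h + 3 <= m.
Proof.
move=> h2 cm kr; have n2 : 2 < h.*2.+1 by lia.
set n := h.*2.+1 in c cm kr n2; rewrite leqNgt; apply/negP=> mh.
have em i : i < 2 * n -> i %% n = if i < n then i else i - n by exact: modn_wrap.
set r := rim_colour c; set s := spoke_colour c.
have rm i : r i < h + 2 by apply: leq_trans (rim_colour_lt i n2 cm) _; lia.
have sm i : s i < h + 2 by apply: leq_trans (spoke_colour_lt i n2 cm) _; lia.
have rmod i : r (i %% n) = r i by exact: rim_colour_mod.
have smod i : s (i %% n) = s i by exact: spoke_colour_mod.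
have rD i : r (i + n) = r i by rewrite -rmod modnDr rmod.
have sD i : s (i + n) = s i by rewrite -smod modnDr smod.
(* Only the shorter arc between antipodal vertices leaves few enough edges. *)
have win0 i : i < n -> uniq (s i :: s (i + h) :: map r (iota i h)).
  move=> ni; have := em (i + h); set j := (i + h) %% n => ej.
  have jn : j < n by rewrite ltn_mod.
  have exy : i + h = j /\ i < j \/ i + h = j + n /\ j < i.
    by move: ej; case: (ltnP (i + h) n); lia.
  have h0 : 0 < h < n by lia.
  have [[_ back] _] := hub_path_arc c ni jn h0 exy.
  rewrite -rainbow_hub_path; apply: back.
  have [| |[? _ _]|[x [y [[xn yn xy] ra sh cov]]]] // :=
    k_rainbow_cover (A := [:: i; j]) (hub := false) n2 cm kr; try lia.
  have := cov i ni; have := cov j jn; rewrite !inE !eqxx orbT /arc_vertex => /(_ isT) vj /(_ isT) vi.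
  suff [-> ->] : i = x /\ j = y by [].
  by move: sh; rewrite /arc_short; lia.
have win i : uniq (s i :: s (i + h) :: map r (iota i h)).
  have := win0 (i %% n) (ltn_pmod _ (ltn0Sn _)).
  rewrite -(smod (_ + h)) modnDml !smod.
  congr (uniq [:: _, _ & _]); rewrite -(addn0 (i %% n)) -{2}(addn0 i) !iotaDl -!map_comp.
  by apply: eq_map => k /=; rewrite -[LHS]rmod -[RHS]rmod modnDml.
have winr i j k : i <= j < i + h -> i <= k < i + h -> r j = r k -> j = k.
  move=> hj hk; have /and3P[_ _ u] := win i; apply: (uniq_map_injective u).
    by rewrite mem_iota.
  by rewrite mem_iota.
have wins i j : i <= j < i + h -> r j <> s i /\ r j <> s (i + h).
  move=> hj; have := win i; rewrite !cons_uniq inE negb_or => /and3P[/andP[_ n1] n3 _].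
  by split=> e; [move: n1 | move: n3]; rewrite -e map_f // mem_iota.
(* Since [2h + 1 > h + 2], two rim edges share a colour. The windows force them to be [h] apart in
   one direction or the other. *)
have [i ei] : exists i, r i = r (i + h).
  have [||i [j [+ + ij e]]] := @pigeonhole r (iota 0 n) (h + 2) (iota_uniq _ _).
  - by rewrite size_iota; lia.
  - by move=> i _; exact: rm.
  rewrite !mem_iota => ni nj.
  have [jh|jh] := ltnP j (i + h); first by have := winr i i j; lia.
  have [jh'|jh'] := ltnP (i + h + 1) j.
    by have := winr j j (i + n); have := rD i; lia.
  have [ej|ej] : j = i + h \/ j = i + h + 1 by lia.
    by exists i; rewrite -ej.
  by exists j; rewrite -e -rD; congr r; lia.
(* The window starting at [i + h + 1] exhausts the [h + 2] colours, so the repeated colour occurs in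
   it. Each possible place is in conflict with another window. *)
have : r i \in s (i + h.+1) :: s (i + h.+1 + h) :: map r (iota (i + h.+1) h).
  apply/negPn/negP=> ri.
  have /size_le_bound : uniq (r i :: s (i + h.+1) :: s (i + h.+1 + h) :: map r (iota (i + h.+1) h)).
    by rewrite cons_uniq ri win.
  move/(_ (h + 2)); rewrite /= size_map size_iota => H.
  suff : h.+3 <= h + 2 by lia.
  apply: H => x; rewrite !inE => /or4P[/eqP->|/eqP->|/eqP->|/mapP[j _ ->]] //.
rewrite !inE => /or3P[/eqP e|/eqP e|/mapP[j]].
- have [|_ []] := wins i.+1 (i + h); first by lia.
  by rewrite -ei e addSnnS.
- have [|nr _] := wins i i; first by lia.
  case: nr.
  by rewrite e -(sD i); congr s; lia.
rewrite mem_iota => hj e.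
have [hj'|hj'] := ltnP j (i + h + h).
  by have := winr (i + h) (i + h) j; lia.
by have := winr j j (i + n); have := rD i; lia.
Qed.

(** * Lower bounds for three vertices *)

Definition clash (r : nat -> nat) n i j := [&& i < j, j < n & r i == r j].

(** As [m < n], the rim is not rainbow, so the covering cycle passes through the hub and its arc
    contains no clashing pair. *)
Lemma rainbow3_arc n m c a b d : 2 < n -> m < n ->
    colouring_with (wheel_adj n) m c -> k_rainbow_cycle_colouring (wheel_adj n) 3 c ->
    a < n -> b < n -> d < n ->
  exists x y, [/\ [&& x < n, y < n & x != y], arc_short n m x y,
    [&& arc_vertex x y a, arc_vertex x y b & arc_vertex x y d]
    & forall i j, clash (rim_colour c) n i j -> ~~ (arc_edge x y i && arc_edge x y j)].
Proof.
move=> n2 mn cm kr an bn dn.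
have [| |[? _ _]|[x [y [[xn yn xy] [_ _ inj] sh cov]]]] // :=
  k_rainbow_cover (A := [:: a; b; d]) (hub := false) n2 cm kr; try lia.
exists x, y; split; rewrite ?xn ?yn //.
  by rewrite !cov ?inE ?eqxx ?orbT.
move=> i j /and3P[ij jn /eqP e]; apply/negP=> /andP[ei ej].
by have := inj i j (ltn_trans ij jn) jn ei ej e; lia.
Qed.

Section ThreeVertices.

Variables (n m : nat) (c : {set 'I_n.+1} -> nat).
Hypotheses (n2 : 2 < n) (mn : m < n) (cm : colouring_with (wheel_adj n) m c)
  (kr : k_rainbow_cycle_colouring (wheel_adj n) 3 c).
Let r := rim_colour c.

(* The three vertices chosen in each of these arguments cut the rim into gaps,
   none of which can be the one that a rainbow cycle omits. *)
Lemma no_triple_clash i j l : clash r n i j -> clash r n j l -> False.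
Proof.
move=> ij jl; have il : clash r n i l by move: ij jl; rewrite /clash; lia.
(* Each gap between these vertices contains just one of the three edges, so the other two remain on
   the arc. *)
have [|||x [y [xy _ vs nc]]] := rainbow3_arc (a := i) (b := j) (d := l) n2 mn cm kr.
1-3: by move: ij jl; rewrite /clash; lia.
have := nc _ _ ij; have := nc _ _ jl; have := nc _ _ il.
by move: ij jl xy vs; rewrite /clash /arc_edge /arc_vertex; lia.
Qed.

(** A common first edge would give three edges of one colour. *)
Lemma clash_neq i j k l : clash r n i j -> clash r n k l -> l != j -> i != k.
Proof.
move=> ij kl lj; apply/eqP=> e; subst k; have [h|h|h] := ltngtP j l.
- by apply: (no_triple_clash ij (l := l)); move: ij kl; rewrite /clash h; lia.
- by apply: (no_triple_clash kl (l := j)); move: ij kl; rewrite /clash h; lia.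
by rewrite h eqxx in lj.
Qed.

(** Pairs that do not interleave are separated or nested. In either case the three vertices are
    chosen so that every gap misses one of the pairs entirely. *)
Lemma clashes_cross p1 p2 q1 q2 : clash r n p1 p2 -> clash r n q1 q2 -> p1 < q1 ->
  q1 < p2 < q2.
Proof.
move=> hp hq pq; apply/negPn/negP=> ncr.
have ne : p2 != q1 by apply/eqP=> e; apply: (no_triple_clash hp); rewrite e; exact: hq.
have ne2 : p2 != q2.
  apply/eqP=> e; apply: (@no_triple_clash p1 q1 q2) => //.
  by move: hp hq; rewrite /clash e; lia.
have [h|h] := ltnP p2 q1.
  have [|||x [y [xy _ vs nc]]] := rainbow3_arc (a := p1) (b := p2.+1) (d := q1.+1) n2 mn cm kr.
  1-3: by move: hp hq; rewrite /clash; lia.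
  have := nc _ _ hp; have := nc _ _ hq.
  by move: hp hq xy vs; rewrite /clash /arc_edge /arc_vertex; lia.
have [|||x [y [xy _ vs nc]]] := rainbow3_arc (a := q1) (b := q2) (d := q2.+1) n2 mn cm kr.
1-3: by move: hp hq; rewrite /clash; lia.
have := nc _ _ hp; have := nc _ _ hq.
by move: hp hq xy vs; rewrite /clash /arc_edge /arc_vertex; lia.
Qed.

(** Pairwise interleaving gives the order [p1, q1, t1, p2, q2, t2]. The gaps between the vertices
    [p1], [t1] and [q2] miss the pairs [t], [q] and [p] respectively. *)
Lemma no_three_clashes p1 p2 q1 q2 t1 t2 :
  clash r n p1 p2 -> clash r n q1 q2 -> clash r n t1 t2 -> p1 < q1 -> q1 < t1 -> False.
Proof.
move=> hp hq ht pq qt; have pt := ltn_trans pq qt.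
have := clashes_cross hp hq pq; have := clashes_cross hq ht qt.
have := clashes_cross hp ht pt => c1 c2 c3.
have [|||x [y [xy _ vs nc]]] := rainbow3_arc (a := p1) (b := t1) (d := q2) n2 mn cm kr.
1-3: by move: hp hq ht; rewrite /clash; lia.
have := nc _ _ hp; have := nc _ _ hq; have := nc _ _ ht.
by move: hp hq ht xy vs; rewrite /clash /arc_edge /arc_vertex; lia.
Qed.

Lemma two_clashes_bound p1 p2 q1 q2 :
  clash r n p1 p2 -> clash r n q1 q2 -> p1 < q1 -> m.+2 <= n -> 12 <= n.
Proof.
move=> hp hq pq mn2; rewrite leqNgt; apply/negP=> n12.
have cr := clashes_cross hp hq pq.
have step a b d : a < n -> b < n -> d < n ->
    (forall x y, [&& x < n, y < n & x != y] -> arc_short n m x y ->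
       [&& arc_vertex x y a, arc_vertex x y b & arc_vertex x y d] ->
       ~~ (arc_edge x y p1 && arc_edge x y p2) ->
       ~~ (arc_edge x y q1 && arc_edge x y q2) -> False) -> False.
  move=> an bn dn H; have [x [y [xy sh vs nc]]] := rainbow3_arc n2 mn cm kr an bn dn.
  exact: (H x y xy sh vs (nc _ _ hp) (nc _ _ hq)).
move: hp hq; rewrite /clash => hp hq.
(* The four cyclic distances add up to [n <= 11], so one is at most 2. The chosen vertices leave
   only one gap meeting both pairs, and it has at most 3 edges; omitting it gives a cycle of at
   least [n - 1 > m] edges. *)
have [h|[h|[h|h]]] : q1 - p1 <= 2 \/ p2 - q1 <= 2 \/ q2 - p2 <= 2 \/ p1 + n - q2 <= 2 by lia.
- by apply: (step p1 q1.+1 p2.+1); try lia; move=> x y; rewrite /arc_short /arc_edge /arc_vertex; lia.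
(* Here the vertex after the edge [q2] is 0. *)
- have [e|e] : q2.+1 = n \/ q2.+1 < n by lia.
    by apply: (step 0 q1 p2.+1); try lia; move=> x y; rewrite /arc_short /arc_edge /arc_vertex; lia.
  by apply: (step q1 p2.+1 q2.+1); try lia; move=> x y; rewrite /arc_short /arc_edge /arc_vertex; lia.
- have [e|e] : q2.+1 = n \/ q2.+1 < n by lia.
    by apply: (step 0 p1.+1 p2); try lia; move=> x y; rewrite /arc_short /arc_edge /arc_vertex; lia.
  by apply: (step p1.+1 p2 q2.+1); try lia; move=> x y; rewrite /arc_short /arc_edge /arc_vertex; lia.
- by apply: (step p1.+1 q1.+1 q2); try lia; move=> x y; rewrite /arc_short /arc_edge /arc_vertex; lia.
Qed.

Lemma clash_bound i j : clash r n i j -> 8 <= n.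
Proof.
move=> ij; rewrite leqNgt; apply/negP=> n8.
have step a b d : a < n -> b < n -> d < n ->
    (forall x y, [&& x < n, y < n & x != y] -> arc_short n m x y ->
       [&& arc_vertex x y a, arc_vertex x y b & arc_vertex x y d] ->
       ~~ (arc_edge x y i && arc_edge x y j) -> False) -> False.
  move=> an bn dn H; have [x [y [xy sh vs nc]]] := rainbow3_arc n2 mn cm kr an bn dn.
  exact: (H x y xy sh vs (nc _ _ ij)).
move: ij; rewrite /clash => ij.
pose up k := if k < n then k else k - n.
(* One of the two cyclic distances is at most 3 because [n <= 7]. The vertex [b] splits the span
   from [k] to [l + 1] into gaps of at most 2 edges, whose omission leaves a cycle of at least
   [n > m] edges; the third gap contains neither edge of the pair. *)
have near k l : k < n -> k < l -> l <= k + 3 -> l.+1 < k + n ->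
    (k = i /\ l = j) \/ (k = j /\ l = i + n) -> False.
  move=> kn kl lk lkn ekl; pose b := if l == k.+1 then l else l.-1.
  apply: (step k (up b) (up l.+1)); rewrite /b /up; try by (do ?case: ifP; lia).
  move=> x y; rewrite /arc_short /arc_edge /arc_vertex.
  by do ?case: ifP; lia.
have [h|h] := leqP j (i + 3); last by apply: (near j (i + n)); lia.
have [h'|h'] := ltnP j.+1 (i + n); first by apply: (near i j); lia.
by apply: (near j (i + n)); lia.
Qed.

Lemma rainbow3_bound : n - 2 <= m /\ (n <= 11 -> n - 1 <= m) /\ 8 <= n.
Proof.
have rm (s : seq nat) : {in s, forall i, r i < m} by move=> i _; exact: rim_colour_lt.
have find s : uniq s -> m < size s -> {subset s <= iota 0 n} ->
    exists i j, [/\ i \in s, j \in s & clash r n i j].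
  move=> us ms sn; have [i [j [si sj ij e]]] := pigeonhole us ms (rm s).
  exists i, j; split=> //; rewrite /clash ij e eqxx andbT.
  by have := sn _ sj; rewrite mem_iota.
have [||//|i [j [_ _ ij]]] := find (iota 0 n); rewrite ?iota_uniq ?size_iota //.
have n8 := clash_bound ij.
have [jn jn'] : i < n /\ j < n by move: ij; rewrite /clash; lia.
(* Dropping the second edge of each clash already found yields a further clash with a different
   second edge, hence with a different first edge. *)
suff : m.+1 < n -> 12 <= n /\ n - 2 <= m by lia.
move=> mn2; pose s1 := rem j (iota 0 n).
have us1 : uniq s1 by rewrite rem_uniq ?iota_uniq.
have ss1 : size s1 = n.-1 by rewrite size_rem ?size_iota ?mem_iota.
have ms1 k : k \in s1 -> k != j /\ k \in iota 0 n.
  by rewrite (mem_rem_uniq _ (iota_uniq _ _)) inE => /andP.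
have [||| k [l [ks ls kl]]] := find s1; rewrite ?ss1 //; first by lia.
  by move=> k /ms1[].
have [kj kn] := ms1 _ ks; have [lj ln] := ms1 _ ls.
have ik := clash_neq ij kl lj.
have mns : n - 2 <= m.
  rewrite leqNgt; apply/negP=> mn3.
  pose s2 := rem l s1.
  have ms2 t : t \in s2 -> t != l /\ t \in s1.
    by rewrite (mem_rem_uniq _ us1) inE => /andP.
  have us2 : uniq s2 by rewrite rem_uniq.
  have ss2 : size s2 = n.-2 by rewrite size_rem ?ss1.
  have [||| u [w [us ws uw]]] := find s2; rewrite ?ss2 //; first by lia.
    by move=> t /ms2[_ /ms1[]].
  have [wl /ms1[wj _]] := ms2 _ ws.
  have [iu ku] := (clash_neq ij uw wj, clash_neq kl uw wl).
  (* Six of the eight sign patterns are the possible orders of the first edges; the other two are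
     cyclic. *)
  have three := no_three_clashes; move: iu ku (ik); rewrite !neq_ltn.
  case/orP=> h3 /orP[h2|h2] /orP[h1|h1].
  - exact: three ij kl uw h1 h2.
  - exact: three kl ij uw h1 h3.
  - exact: three ij uw kl h3 h2.
  - by have := ltn_trans h2 h1; rewrite ltnNge (ltnW h3).
  - by have := ltn_trans h1 h2; rewrite ltnNge (ltnW h3).
  - exact: three kl uw ij h2 h3.
  - exact: three uw ij kl h3 h1.
  - exact: three uw kl ij h2 h1.
by split=> //; case: (ltngtP i k) ik => // h _; [apply: (two_clashes_bound ij kl) | apply: (two_clashes_bound kl ij)]; lia.
Qed.

End ThreeVertices.

(* For [k >= 4] a set may contain both ends of two rim edges of the same colour:
   then no arc omits one of them, unless it is Hamiltonian. *)
Lemma rainbow4_rim n m k c : 2 < n -> 4 <= k <= n.+1 -> m <= n ->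
    colouring_with (wheel_adj n) m c -> k_rainbow_cycle_colouring (wheel_adj n) k c ->
  m = n /\ forall i j, i < n -> j < n -> rim_colour c i = rim_colour c j -> i = j.
Proof.
move=> n2 kn mn cm kr.
have inj i j : i < n -> j < n -> rim_colour c i = rim_colour c j -> i = j.
  move=> ni nj e; apply/eqP/negPn/negP=> /eqP ij.
  pose i' := if i.+1 < n then i.+1 else 0; pose j' := if j.+1 < n then j.+1 else 0.
  have i'n : i' < n by rewrite /i'; case: ifP; lia.
  have j'n : j' < n by rewrite /j'; case: ifP; lia.
  have [| |[? _ H]|[x [y [[xn yn xy] [_ _ H] sh cov]]]] :=
    k_rainbow_cover (A := [:: i; i'; j; j']) (hub := false) n2 cm kr; first by rewrite /=; lia.
  - by lia.
  - by apply: ij; apply: H.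
  have := cov _ ni; have := cov _ i'n; have := cov _ nj; have := cov _ j'n.
  rewrite !inE !eqxx !orbT => /(_ isT) vj' /(_ isT) vj /(_ isT) vi' /(_ isT) vi.
  clear kr cm cov.
  (* An arc through both ends of the edge that avoids the edge itself has [n - 1] edges, too many
     with two spokes added. *)
  have ei : arc_edge x y i.
    by move: vi vi' sh; rewrite /i' /arc_edge /arc_vertex /arc_short; case: ifP; clear -xn yn xy ni mn; lia.
  have ej : arc_edge x y j.
    by move: vj vj' sh; rewrite /j' /arc_edge /arc_vertex /arc_short; case: ifP; clear -xn yn xy nj mn; lia.
  by apply: ij; apply: H.
split=> //; apply/eqP; rewrite eqn_leq mn /=.
rewrite -{1}(size_iota 0 n) -(size_map (rim_colour c)); apply: size_le_bound.
  rewrite map_inj_in_uniq ?iota_uniq // => i j; rewrite !mem_iota => ni nj.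
  by apply: inj; lia.
by move=> _ /mapP[i _ ->]; exact: rim_colour_lt.
Qed.

Lemma half_le n a b : a + b <= n -> n./2 < a -> b <= n./2.
Proof. by have := odd_double_half n; case: odd => /=; lia. Qed.

(** * Piercing a family of arcs of the circle by few vertices *)

Section Piercing.

Variables (n : nat) (D : nat -> nat -> bool).
Hypothesis D_range : forall x g, D x g -> x < n /\ 2 <= g < n.
(** [D x g] stands for the arc of [g] edges starting at [x]. Arcs of the family that meet end to
    start must overlap at their other ends as well. *)
Hypothesis D_ends : forall x y g h, D x g -> D y h -> (y + h) %% n = x -> n < g + h.

(** Minimality under inclusion: [o] is the offset of a subarc. An interior vertex of a minimal arc
    pierces every arc containing it. *)
Let minimal x g := D x g &&
  [forall o : 'I_n, forall g' : 'I_n, D ((x + o) %% n) g' && (o + g' <= g) ==> (g' == g :> nat)].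

Let minimal_sub x g o g' : minimal x g -> D ((x + o) %% n) g' -> o + g' <= g -> g' = g.
Proof.
case/andP=> Dx /forallP H Do le.
have [[_ gn] [_ gn']] := (D_range Dx, D_range Do).
have on : o < n by lia.
have g'n : g' < n by lia.
by have /forallP/(_ (Ordinal g'n)) := H (Ordinal on); rewrite /= Do le => /eqP.
Qed.

Let minimal_exists x g : D x g -> exists o g', o + g' <= g /\ minimal ((x + o) %% n) g'.
Proof.
elim/ltn_ind: g x => g IHg x Dx.
have [[xn gn]] := D_range Dx.
have [Mx|] := boolP (minimal x g).
  by exists 0, g; rewrite addn0 modn_small.
rewrite /minimal Dx /= => /forallPn[o /forallPn[g']].
rewrite negb_imply => /andP[/andP[Do le] ne].
have [|o' [g'' [le' M']]] := IHg g' _ ((x + o) %% n) Do; first by lia.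
by exists (o + o'), g''; rewrite addnA -modnDml; split=> //; lia.
Qed.

(* If no vertex both starts and ends a minimal arc, the successors of the starts
   or the predecessors of the ends are few.  Otherwise two minimal arcs meeting
   in [z] cover the circle, and their three end points pierce everything. *)
Lemma piercing_set : exists A : seq nat, size A <= maxn 3 n./2 /\
  forall x g, D x g -> exists o, 0 < o < g /\ (x + o) %% n \in A.
Proof.
pose st x := [exists g : 'I_n, minimal x g].
pose en z := [exists x : 'I_n, exists g : 'I_n, minimal x g && ((x + g) %% n == z)].
have stP x g : minimal x g -> x < n /\ st x.
  move=> Mx; have [Dx _] := andP Mx; have [xn /andP[_ gn]] := D_range Dx.
  by split=> //; apply/existsP; exists (Ordinal gn).
have enP x g : minimal x g -> (x + g) %% n < n /\ en ((x + g) %% n).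
  move=> Mx; have [Dx _] := andP Mx; have [xn /andP[_ gn]] := D_range Dx.
  split; first by rewrite ltn_mod; lia.
  apply/existsP; exists (Ordinal xn); apply/existsP; exists (Ordinal gn).
  by rewrite Mx eqxx.
have [|dis] := boolP (has (predI st en) (iota 0 n)).
  case/hasP=> z _ /andP[/existsP[g1 Mz] /existsP[y0 /existsP[g2 /andP[My /eqP ez]]]].
  have [[Dz _] [Dy _]] := (andP Mz, andP My).
  have [[zn g1n] [y0n g2n]] := (D_range Dz, D_range Dy).
  have ey0 : (z + (n - g2)) %% n = y0.
    by rewrite -ez modnDml -addnA subnKC ?modnDr ?modn_small //; lia.
  exists [:: z; y0 : nat; (z + g1) %% n]; split; first by rewrite /= leq_maxl.
  move=> x0 g0 /minimal_exists[o0 [g [le Mx]]].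
  suff [o [og oA]] : exists o, 0 < o < g /\ (x0 + o0 + o) %% n \in [:: z; y0 : nat; (z + g1) %% n].
    by exists (o0 + o); rewrite addnA; split=> //; lia.
  move: Mx; set x := (x0 + o0) %% n => Mx.
  suff [o [og oA]] : exists o, 0 < o < g /\ (x + o) %% n \in [:: z; y0 : nat; (z + g1) %% n].
    by exists o; rewrite -modnDml.
  have [Dx _] := andP Mx; have [xn gn] := D_range Dx.
  (* All positions are measured from [z]: the arc in question starts at offset [a], and [y0] is at
     offset [n - g2]. *)
  have [a an ea] : exists2 a, a < n & (z + a) %% n = x.
    exists ((x + (n - z)) %% n); first by rewrite ltn_mod; lia.
    by rewrite modnDmr addnCA subnKC ?modnDr ?modn_small //; lia.
  have at_z o : o + a = n -> (x + o) %% n = z.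
    by move=> e; rewrite -ea modnDml -addnA (addnC a) e modnDr modn_small.
  have at_y0 o : a + o = n - g2 -> (x + o) %% n = y0.
    by move=> e; rewrite -ea modnDml -addnA e.
  have cov1 := D_ends Dz Dy ez.
  case: (posnP a) => [a0|a0].
    have exz : x = z by rewrite -ea a0 addn0 modn_small.
    exists (n - g2); rewrite at_y0 ?a0 // !inE eqxx orbT; split=> //.
    by have := D_ends (x := x) _ Dy; rewrite exz => /(_ g); rewrite -{1}exz => /(_ Dx ez); lia.
  have [h|h] := ltnP n (a + g).
    exists (n - a); rewrite at_z ?subnK ?inE ?eqxx ?(ltnW an) //; split=> //.
    by rewrite subn_gt0 an ltn_subLR // ltnW.
  have [h1|h1] := leqP (a + g) g1.
    have eg : g = g1 by apply: (@minimal_sub z g1 a); rewrite ?ea.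
    by move: a0 h1; rewrite eg; clear; lia.
  have [h2|h2] := ltnP a (n - g2).
    exists (n - g2 - a); rewrite at_y0 ?subnKC ?inE ?eqxx ?orbT ?(ltnW h2) //.
    by split=> //; move: h2 h1 cov1; clear; lia.
  have [y0_a le2] : n - g2 + (a - (n - g2)) = a /\ a - (n - g2) + g <= g2.
    by move: h2 h g2n; clear; lia.
  have eg : g = g2.
    by apply: (@minimal_sub y0 g2 (a - (n - g2))); rewrite // -ey0 modnDml -addnA y0_a ea.
  have ag1 : a < g1 by move: le2 cov1 g2n; rewrite eg; clear; lia.
  exists (g1 - a); split; first by move: ag1 h1; clear; lia.
  by rewrite -ea modnDml -addnA subnKC ?inE ?eqxx ?orbT // ltnW.
(* Starts and ends are disjoint sets of vertices, so one of the two has at most [n./2] elements. *)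
have cnt : count st (iota 0 n) + count en (iota 0 n) <= n.
  rewrite -count_predUI -[X in _ <= X](size_iota 0) -[X in _ <= X]addn0.
  apply: leq_add; first exact: count_size.
  by rewrite leqn0 -leqn0 leqNgt -has_count.
have [le|lt] := leqP (count st (iota 0 n)) n./2.
  exists [seq x.+1 %% n | x <- iota 0 n & st x]; rewrite size_map size_filter.
  split; first by rewrite leq_max le orbT.
  move=> x g /minimal_exists[o [g' [og Mx]]]; have [Dx _] := andP Mx.
  have [_ gn] := D_range Dx; have [xn sx] := stP _ _ Mx.
  exists o.+1; split; first by lia.
  apply/mapP; exists ((x + o) %% n); first by rewrite mem_filter sx mem_iota.
  by rewrite -(addn1 (_ %% n)) modnDml addn1 addnS.
(* Adding [n.-1] gives the predecessor modulo [n]; it is interior because the arcs have at least two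
   edges. *)
exists [seq (x + n.-1) %% n | x <- iota 0 n & en x]; rewrite size_map size_filter.
split; first by rewrite leq_max (half_le cnt lt) orbT.
move=> x g /minimal_exists[o [g' [og Mx]]]; have [Dx _] := andP Mx.
have [xon gn] := D_range Dx; have [xn sx] := enP _ _ Mx.
exists (o + g'.-1); split; first by lia.
apply/mapP; exists (((x + o) %% n + g') %% n); first by rewrite mem_filter sx mem_iota.
rewrite modnDml -addnA modnDml (_ : x + o + (g' + n.-1) = x + (o + g'.-1) + n) ?modnDr //; lia.
Qed.

End Piercing.

(** A hub cycle over the arc from [x] to [y] omits the arc from [y] to [x], which must contain the
    rim edges coloured like the two spokes. Piercing all such arcs costs at most [k - 1] vertices if
    [n < 2 * k], and the hub is the last vertex of the bad set. *)
Lemma rainbow4_bound n m k c : 2 < n -> 4 <= k <= n.+1 -> m <= n ->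
    colouring_with (wheel_adj n) m c -> k_rainbow_cycle_colouring (wheel_adj n) k c ->
  m = n /\ 2 * k <= n.
Proof.
move=> n2 kn mn cm kr; have [emn inj] := rainbow4_rim n2 kn mn cm kr; subst m.
split=> //; rewrite leqNgt; apply/negP=> nk; have n0 : 0 < n by lia.
have onto x : x < n -> exists2 e, e < n & rim_colour c e = spoke_colour c x.
  move=> xn; suff /mapP[e] : spoke_colour c x \in map (rim_colour c) (iota 0 n).
    by rewrite mem_iota => en ->; exists e.
  apply/negPn/negP=> sx.
  have /size_le_bound : uniq (spoke_colour c x :: map (rim_colour c) (iota 0 n)).
    rewrite cons_uniq sx map_inj_in_uniq ?iota_uniq // => i j; rewrite !mem_iota => ni nj.
    by apply: inj; lia.
  move/(_ n); rewrite /= size_map size_iota ltnn => H; suff : false by []; apply: H.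
  by move=> y; rewrite inE => /predU1P[->|/mapP[i _ ->]]; [exact: spoke_colour_lt | exact: rim_colour_lt].
pose t x := index (spoke_colour c x) (map (rim_colour c) (iota 0 n)).
have tP x : x < n -> t x < n /\ rim_colour c (t x) = spoke_colour c x.
  move=> xn; have [e en ee] := onto x xn.
  have sx : spoke_colour c x \in map (rim_colour c) (iota 0 n).
    by rewrite -ee map_f // mem_iota.
  have tn : t x < n by move: sx; rewrite -index_mem size_map size_iota.
  split=> //; have := nth_index 0 sx; rewrite -/(t x) (nth_map 0) ?size_iota //.
  by rewrite nth_iota.
have emod i : i < 2 * n -> i %% n = if i < n then i else i - n by exact: modn_wrap.
(* [D x g]: the arc of [g] edges starting at [x] contains the rim edges that
   share their colour with the spokes at its two ends. *)
pose D x g := [&& x < n, 2 <= g, g < n, ~~ arc_edge ((x + g) %% n) x (t x)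
  & ~~ arc_edge ((x + g) %% n) x (t ((x + g) %% n))].
have [||A [sA hA]] := @piercing_set n D.
- by move=> x g /and5P[-> -> ->].
(* The edge [t x] lies in both arcs, which would be edge-disjoint if [g + h <= n]. *)
- move=> x y g h /and5P[xn g2 gn + _] /and5P[yn h2 hn _ +] eyh; rewrite eyh.
  have [tn _] := tP _ xn; move: (t x) tn eyh => e en.
  rewrite !emod; [|lia..].
  by rewrite /arc_edge; case: (ltnP (x + g) n); case: (ltnP (y + h) n); clear -n0 xn g2 gn yn h2 hn en; lia.
have [|| [? H _]|[x [y [[xn yn xy] [_ spk _] sh cov]]]] :=
    k_rainbow_cover (A := A) (hub := true) n2 cm kr.
- by move: sA; lia.
- by lia.
- by [].
(* The number of edges of the omitted arc; [arc_short] makes it at least 2. *)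
pose g := if x < y then x + n - y else x - y.
have eyg : (y + g) %% n = x.
  by rewrite /g; case: (ltnP x y) => ?; (rewrite emod; [case: ifP; lia | lia]).
have off e : e < n -> rim_colour c e = spoke_colour c x \/ rim_colour c e = spoke_colour c y ->
    ~~ arc_edge x y e.
  by move=> en h; apply/negP=> ha; have [h1 h2] := spk e en ha; case: h.
have [[tx ex] [ty ey]] := (tP _ xn, tP _ yn).
have [|o [og /cov]] := hA y g.
  rewrite /D eyg yn (off _ tx (or_introl ex)) (off _ ty (or_intror ey)).
  by move: sh; rewrite /g /arc_short; case: ltnP; lia.
rewrite ltn_mod n0 => /(_ isT); rewrite emod; last by move: og; rewrite /g; case: ifP; lia.
by move: og; rewrite /g /arc_vertex; case: (ltnP x y); case: (ltnP (y + o) n); lia.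
Qed.

(** * Upper bounds *)

(** The two indices may coincide, and are 0 if the set has no rim vertex. *)
Lemma rim_members_le2 n (S : {set 'I_n.+1}) : 0 < n -> #|S| <= 2 ->
  exists i j, i <= j < n /\ forall a, a < n -> rim n a \in S -> (a == i) || (a == j).
Proof.
move=> n0 S2; pose l := [seq a <- iota 0 n | rim n a \in S].
have lP a : a < n -> rim n a \in S -> a \in l by rewrite mem_filter mem_iota => -> ->.
have ln a : a \in l -> a < n by rewrite mem_filter mem_iota => /and3P[].
have : size l <= 2.
  apply: leq_trans S2; rewrite -(size_map (rim n)) cardE; apply: uniq_leq_size.
    rewrite map_inj_in_uniq ?filter_uniq ?iota_uniq // => a b /ln an /ln bn /eqP.
    by rewrite rim_eq // !modn_small // => /eqP.
  by move=> _ /mapP[a al ->]; rewrite mem_enum; move: al; rewrite mem_filter => /andP[].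
case: l lP ln => [|i [|j []]] // lP ln _.
- by exists 0, 0; split=> // a an /(lP a an).
- exists i, i; split; first by rewrite leqnn ln ?inE.
  by move=> a an /(lP a an); rewrite !inE orbb.
have [ij|ij] := leqP i j.
  exists i, j; split; first by rewrite ij ln ?inE ?eqxx ?orbT.
  by move=> a an /(lP a an); rewrite !inE.
exists j, i; split; first by rewrite (ltnW ij) ln ?inE ?eqxx ?orbT.
by move=> a an /(lP a an); rewrite !inE orbC.
Qed.

Lemma free_label n (S : {set 'I_n.+1}) (lab : nat -> nat) h : 0 < n -> #|S| < h ->
  exists t, t < h /\ forall a, a < n -> rim n a \in S -> lab a != t.
Proof.
move=> n0 Sh; pose l := [seq lab (nat_of_ord z) | z <- enum S].
have [/allP H|/allPn[t]] := boolP (all (mem l) (iota 0 h)).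
  have := uniq_leq_size (iota_uniq 0 h) H.
  by rewrite size_iota size_map -cardE leqNgt Sh.
rewrite mem_iota => th tl; exists t; split=> // a an aS; apply: contra tl => /eqP <-.
apply/mapP; exists (rim n a); first by rewrite mem_enum.
by rewrite val_rim // modn_small.
Qed.

Definition crx_le n k m :=
  exists c, colouring_with (wheel_adj n) m c /\ k_rainbow_cycle_colouring (wheel_adj n) k c.

(** Triangles over a rim edge suffice: the rim has one colour and the spokes alternate between the
    other two. *)
Lemma crx1_le n : 2 < n -> crx_le n 1 3.
Proof.
move=> n2; apply: (@wheel_colouring_exists n 1 3 (fun=> 2) (fun i => odd i : nat)) => // [i _|S S1].
  by case: odd.
have n0 : 0 < n by lia.
have [i ni Sa] : exists2 i, i < n & forall a, a < n -> rim n a \in S -> a = i.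
  have [z Sz] : exists z, S = [set z] by apply/cards1P/eqP.
  case: (hub_or_rim z) => [ez|[i ni ez]].
    by exists 0 => // a an; rewrite Sz ez inE rim_neq_hub.
  exists i => // a an; rewrite Sz ez inE rim_eq // !modn_small //.
  by move/eqP.
(* The closing rim edge is avoided, as for odd [n] the spokes at its ends agree in colour. *)
pose x := if i.+1 < n then i else i.-1.
have [xn xi] : x.+1 < n /\ (x = i \/ x.+1 = i) by rewrite /x; case: ifP; lia.
right; exists x, x.+1; split; [lia | lia | lia | split | ].
- by rewrite /=; case: odd.
- by move=> e _ _; do 2 case: odd.
- by rewrite /arc_edge; lia.
by move=> a an /Sa ->; rewrite // /arc_vertex; lia.
Qed.

(** [W_3] is [K_4]; the colour classes are its three perfect matchings, so every triangle is
    rainbow. *)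
Lemma crx2_le3 : crx_le 3 2 3.
Proof.
pose s i := if i == 0 then 1 else if i == 1 then 2 else 0.
apply: (@wheel_colouring_exists 3 2 3 id s) => // [i _|S S1].
  by rewrite /s; do ?case: ifP.
have [|i [j [ij Sa]]] := @rim_members_le2 3 S isT; first by rewrite S1.
have arc x y : x < 3 -> y < 3 -> y = (x + 1) %% 3 -> rainbow_arc 3 id s x y.
  move=> x3 y3 ey; rewrite /rainbow_arc /arc_edge /s.
  have : (x = 0 /\ y = 1) \/ (x = 1 /\ y = 2) \/ (x = 2 /\ y = 0) by lia.
  by case=> [[-> ->]|[[-> ->]|[-> ->]]]; (split; [ | move=> e | move=> e e']); rewrite /=; lia.
right; have [h|h] := leqP j 1.
  by exists 0, 1; split=> //; [exact: arc | move=> a a3 /(Sa a a3); rewrite /arc_vertex; lia].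
have [h'|h'] := leqP 1 i.
  by exists 1, 2; split=> //; [exact: arc | move=> a a3 /(Sa a a3); rewrite /arc_vertex; lia].
by exists 2, 0; split=> //; [exact: arc | move=> a a3 /(Sa a a3); rewrite /arc_vertex; lia].
Qed.

Lemma crx2_le n : 4 <= n -> crx_le n 2 ((n.+1)./2 + 2).
Proof.
move=> n4; set h := (n.+1)./2.
have hn : 2 <= h /\ n <= 2 * h <= n.+1.
  by have := odd_double_half n.+1; rewrite -/h; case: odd => /=; lia.
pose r i := if i < h then i else i - h; pose s i := if i < h then h else h.+1.
apply: (@wheel_colouring_exists n 2 (h + 2) r s); first by lia.
- by move=> i; rewrite /r; case: ifP; lia.
- by move=> i; rewrite /s; case: ifP; lia.
move=> S S2; have [||i [j [ij Sa]]] := @rim_members_le2 n S; rewrite ?S2 //; first by lia.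
(* The spokes differ when the ends lie in different halves. A rim colour recurs after [h] steps, but
   after [n - h] steps across vertex 0, hence the two length conditions. *)
have wit x y : x < n -> y < n -> (x < h) != (y < h) ->
    (x < y /\ y <= x + h \/ y < x /\ y + h <= x) ->
    arc_vertex x y i -> arc_vertex x y j ->
  exists x y, [/\ x < n, y < n, x != y, rainbow_arc n r s x y
        & forall a, a < n -> rim n a \in S -> arc_vertex x y a].
  move=> xn yn hxy len vi vj; exists x, y; split=> //; first by apply/eqP=> e; rewrite e eqxx in hxy.
    rewrite /rainbow_arc /arc_edge /r /s; split.
    - by move: hxy; do 2 case: ifP; lia.
    - by move=> e en ae; do ?case: ifP; lia.
    - by move=> e e' en en'; do ?case: ifP; lia.
  by move=> a an /(Sa a an)/orP[/eqP->|/eqP->].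
right; have [ih|ih] := ltnP i h; last by apply: (wit i 0); rewrite /arc_vertex; lia.
have [jh|jh] := ltnP j h; first by apply: (wit i h); rewrite /arc_vertex; lia.
have [d|d] := leqP j (i + h); first by apply: (wit i j); rewrite /arc_vertex; lia.
by apply: (wit j i); rewrite /arc_vertex; lia.
Qed.

(** The rainbow rim covers the sets without the hub; the others have only two rim vertices. *)
Lemma crx3_le n : 3 <= n -> crx_le n 3 n.
Proof.
move=> n3; pose s i := if i == 1 then 2 else if i == 2 then 0 else 1.
apply: (@wheel_colouring_exists n 3 n id s) => // [i _|S S3].
  by rewrite /s; do ?case: ifP; lia.
have [hS|hS] := boolP (ord_max \in S); [right | by left].
have n0 : 0 < n by lia.
have [||i [j [ij Sa]]] := @rim_members_le2 n (S :\ ord_max) => //.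
  by move: S3; rewrite (cardsD1 ord_max) hS add1n => -[->].
have {}Sa a : a < n -> rim n a \in S -> (a == i) || (a == j).
  by move=> an aS; apply: Sa; rewrite // in_setD1 rim_neq_hub.
have wit x y : x < n -> y < n -> x != y -> s x != s y ->
    (forall e, e < n -> arc_edge x y e -> (e != s x) && (e != s y)) ->
    arc_vertex x y i -> arc_vertex x y j ->
  exists x y, [/\ x < n, y < n, x != y, rainbow_arc n id s x y
        & forall a, a < n -> rim n a \in S -> arc_vertex x y a].
  move=> xn yn xy sxy H vi vj; exists x, y; split=> //.
    by split=> //; [exact/eqP | move=> e en /(H e en)/andP[/eqP ? /eqP ?]].
  by move=> a an /(Sa a an)/orP[/eqP->|/eqP->].
(* If vertex 1 is free, the edges 0 and 1 are omitted, and their colours are those of the end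
   spokes. Similarly for vertex 2; the pair 1, 2 is covered by a triangle. *)
have [h1|h1] := boolP ((i != 1) && (j != 1)).
  by apply: (wit 2 0); rewrite /arc_edge /arc_vertex /s //=; try move=> e; lia.
have [h2|h2] := boolP ((i != 2) && (j != 2)).
  have [n4|n4] := leqP 4 n.
    by apply: (wit 3 1); rewrite /arc_edge /arc_vertex /s //=; try move=> e; lia.
  by apply: (wit 0 1); rewrite /arc_edge /arc_vertex /s //=; try move=> e; lia.
by apply: (wit 1 2); rewrite /arc_edge /arc_vertex /s //=; try move=> e; lia.
Qed.

(* A vertex [a] can be off arc [t] only if [lab a = t], so a set with fewer than [h]
   vertices lies on one of the [h] arcs. *)
Lemma crx_le_of_arcs n k m (lab : nat -> nat) (x y r s : nat -> nat) h : 2 < n ->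
    (forall i, i < n -> r i < m) -> (forall i, i < n -> s i < m) ->
    (k < h \/ k <= h /\ (forall i j, i < n -> j < n -> r i = r j -> i = j)) ->
    (forall t, t < h -> [/\ x t < n, y t < n, x t != y t, rainbow_arc n r s (x t) (y t)
       & forall a, a < n -> lab a != t -> arc_vertex (x t) (y t) a]) ->
  crx_le n k m.
Proof.
move=> n2 rm sm kh H; have n0 : 0 < n by lia.
apply: (@wheel_colouring_exists n k m r s) => // S Sk.
have lift (S' : {set 'I_n.+1}) : #|S'| < h ->
    (forall a, a < n -> rim n a \in S -> rim n a \in S') ->
  exists x y, [/\ x < n, y < n, x != y, rainbow_arc n r s x y
        & forall a, a < n -> rim n a \in S -> arc_vertex x y a].
  move=> Sh SS; have [t [th labt]] := free_label lab n0 Sh.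
  have [xn yn xy ra cov] := H t th; exists (x t), (y t); split=> // a an aS.
  by apply: cov => //; apply: labt => //; exact: SS.
case: kh => [kh|[kh inj]]; first by right; apply: (lift S); rewrite ?Sk.
have [hS|hS] := boolP (ord_max \in S); [right | by left].
apply: (lift (S :\ ord_max)).
  by move: kh; rewrite -Sk (cardsD1 ord_max S) hS add1n.
by move=> a an aS; rewrite in_setD1 rim_neq_hub.
Qed.

Lemma crx3_le_pred n : 8 <= n -> crx_le n 3 (n - 1).
Proof.
move=> n8; pose r i := if i == n.-1 then 3 else i.
pose s i := if i == n.-1 then 0 else nth 1 [:: 6; 1; 1; 4; 2; 5; 5] i.
pose x t := nth 0 [:: 4; 6; 0; 2] t; pose y t := nth 0 [:: 1; 3; 5; n.-1] t.
pose lab a := if a < 2 then 3 else if a < 4 then 0 else if a < 6 then 1 else 2.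
apply: (@crx_le_of_arcs n 3 (n - 1) lab x y r s 4); first by lia.
- by move=> i; rewrite /r; case: ifP; lia.
- move=> i; rewrite /s; case: ifP; first by lia.
  suff : nth 1 [:: 6; 1; 1; 4; 2; 5; 5] i <= 6 by lia.
  by do 8 case: i => [//|i].
- by left.
have s0 : s n.-1 = 0 by rewrite /s eqxx.
have sv i : i < 7 -> s i = nth 1 [:: 6; 1; 1; 4; 2; 5; 5] i.
  by move=> i7; rewrite /s; case: ifP => // /eqP; lia.
move=> t t4; have : t = 0 \/ t = 1 \/ t = 2 \/ t = 3 by lia.
case=> [->|[->|[->|->]]]; rewrite /x /y /= /rainbow_arc ?s0 ?sv //=;
  (split; [lia | lia | lia | split; [by [] | move=> e en | move=> e e' en en'] | move=> a an]);
  rewrite /arc_edge /arc_vertex /lab /r; do ?case: ifP; lia.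
Qed.

Lemma crx3_le_pred2 n : 12 <= n -> crx_le n 3 (n - 2).
Proof.
move=> n12.
(* The repeated pairs are the edges 0, 6 and 3, 9. Each omitted arc starts with one of these four
   edges and ends with the next, and its two inner edges next to an end give the colours of the end
   spokes or, across vertex 0, edges 10 and 11 do. *)
pose r i := if i < 6 then i else if i == 6 then 0 else if i < 9 then i.-1
            else if i == 9 then 3 else i - 2.
pose s i := nth 0 [:: 1; 9; 0; 4; 2; 0; 6; 5; 0; 8; 7] i.
pose x t := nth 0 [:: 4; 7; 10; 1] t; pose y t := nth 0 [:: 0; 3; 6; 9] t.
pose lab a := if a < 1 then 3 else if a < 4 then 0 else if a < 7 then 1
              else if a < 10 then 2 else 3.
apply: (@crx_le_of_arcs n 3 (n - 2) lab x y r s 4); first by lia.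
- by move=> i; rewrite /r; do ?case: ifP; lia.
- move=> i _; suff : s i <= 9 by lia.
  by rewrite /s; do 12 case: i => [//|i].
- by left.
move=> t t4; have : t = 0 \/ t = 1 \/ t = 2 \/ t = 3 by lia.
case=> [->|[->|[->|->]]]; rewrite /x /y /= /rainbow_arc /s /=;
  (split; [lia | lia | lia | split; [by [] | move=> e en | move=> e e' en en'] | move=> a an]);
  rewrite /arc_edge /arc_vertex /lab /r; do ?case: ifP; lia.
Qed.

(** A single Hamiltonian cycle is rainbow: it omits rim edge [n - 1], whose colour goes to one
    spoke, while the other spoke gets the extra colour [n]. *)
Lemma crx_le_succ n k : 3 <= n -> crx_le n k n.+1.
Proof.
move=> n3; pose s i := if i == 0 then n else n.-1.
apply: (@wheel_colouring_exists n k n.+1 id s) => // [i ni|i ni|S _].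
- exact: ltnW.
- by rewrite /s; case: ifP; lia.
right; exists 0, n.-1; split; try lia; last by move=> a an _; rewrite /arc_vertex; lia.
split=> //; first by rewrite /s /=; case: ifP; lia.
by move=> e en; rewrite /arc_edge /s /=; case: ifP; lia.
Qed.

(* The missing arcs [2t - 1, 2t + 2] (truncated to [0, 2] and [2k - 3, 2k - 1] at
   the two extremes) have pairwise disjoint interiors and no common end points, so
   that one spoke colour per vertex suffices. *)
Lemma crx_le_rim n k : 4 <= k -> 2 * k <= n -> crx_le n k n.
Proof.
move=> k4 kn.
(* The spoke at the start of an omitted arc takes the colour of the first omitted edge, the one at
   its end that of the last. *)
pose s i := if (i == 0) || odd i && (i < 2 * k - 1) then i else i.-1.
pose x t := if t == k.-1 then 2 * k - 1 else 2 * t + 2.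
pose y t := 2 * t - (0 < t).
apply: (@crx_le_of_arcs n k n half x y id s k); first by lia.
- by [].
- by move=> i ni; rewrite /s; case: ifP; lia.
- by right.
move=> t tk.
have sx : s (x t) = (x t).-1.
  rewrite /s /x; case: (t == k.-1); first by rewrite ltnn andbF orbF; case: eqP => // ->.
  by rewrite addn2 /= mul2n odd_double.
have sy : s (y t) = y t.
  rewrite /s /y; case: t tk {sx} => [|t] tk; first by rewrite muln0.
  have -> : 2 * t.+1 - (0 < t.+1) = t.*2.+1 by rewrite /=; lia.
  by rewrite /= odd_double /=; case: ifP => //; lia.
split; try by (rewrite /x /y; try case: ifP; lia).
  split; rewrite ?sx ?sy.
  - by rewrite /x /y; case: ifP; lia.
  - by move=> e en; rewrite /arc_edge /x /y; case: ifP; lia.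
  - by [].
move=> a an; rewrite /arc_vertex /x /y => at_; have := odd_double_half a.
by case: odd => /=; case: ifP; lia.
Qed.

Lemma crx_isI n k m : crx_le n k m ->
    (forall m' c, m' < m -> colouring_with (wheel_adj n) m' c ->
       k_rainbow_cycle_colouring (wheel_adj n) k c -> False) ->
  crx_is (wheel_adj n) k m.
Proof. by move=> le lb; split=> // m' m'm [c [cm kr]]; exact: lb m'm cm kr. Qed.

Theorem theorem3p1 :
  (forall n, 3 <= n -> crx_is (wheel_adj n) 1 3) /\
  (crx_is (wheel_adj 3) 2 3 /\
   forall n, 4 <= n -> crx_is (wheel_adj n) 2 ((n.+1)./2 + 2)) /\
  ((forall n, 3 <= n <= 7 -> crx_is (wheel_adj n) 3 n) /\
   (forall n, 8 <= n <= 11 -> crx_is (wheel_adj n) 3 (n - 1)) /\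
   (forall n, 12 <= n -> crx_is (wheel_adj n) 3 (n - 2))) /\
  (forall k n, 4 <= k -> k <= n.+1 ->
     (n < 2 * k -> crx_is (wheel_adj n) k n.+1) /\
     (2 * k <= n -> crx_is (wheel_adj n) k n)).
Proof.
split; [|split; [split|split; [split; [|split]|move=> k n k4 kn; split]]].
- move=> n n3; apply: crx_isI; first exact: crx1_le.
  by move=> m c m3 cm /(rainbow_colouring_ge3 n3 (ltn0Sn _) cm); lia.
- apply: crx_isI crx2_le3 _ => m c m3 cm /(@rainbow_colouring_ge3 3 2 m c isT isT cm).
  by lia.
- move=> n n4; apply: crx_isI; first exact: crx2_le.
  have [h [en|en]] : exists h, n = h.*2.+1 \/ n = h.*2.
    by exists n./2; have := odd_double_half n; case: odd => /=; lia.
  - subst n => m c mh cm kr; have h2 : 2 <= h by lia.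
    by have := rainbow2_odd_bound h2 cm kr; lia.
  - subst n => m c mh cm kr; have h2 : 2 <= h by lia.
    by have := rainbow2_even_bound h2 cm kr; lia.
- move=> n n37; apply: crx_isI; first by apply: crx3_le; lia.
  (* Fewer than [n] colours already force [8 <= n]. *)
  move=> m c mn cm kr; have n3 : 2 < n by lia.
  by have [_ [_]] := rainbow3_bound n3 mn cm kr; lia.
- move=> n n811; apply: crx_isI; first by apply: crx3_le_pred; lia.
  move=> m c mn cm kr; have n3 : 2 < n by lia.
  have mn' : m < n by lia.
  by have [_ []] := rainbow3_bound n3 mn' cm kr; lia.
- move=> n n12; apply: crx_isI; first exact: crx3_le_pred2.
  move=> m c mn cm kr; have n3 : 2 < n by lia.
  have mn' : m < n by lia.
  by have [] := rainbow3_bound n3 mn' cm kr; lia.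
- move=> nk; apply: crx_isI; first by apply: crx_le_succ; lia.
  move=> m c mn cm kr; have [n3 k4n mn'] : [/\ 2 < n, 4 <= k <= n.+1 & m <= n] by split; lia.
  by have [_] := rainbow4_bound n3 k4n mn' cm kr; lia.
- move=> nk; apply: crx_isI; first exact: crx_le_rim.
  move=> m c mn cm kr; have [n3 k4n mn'] : [/\ 2 < n, 4 <= k <= n.+1 & m <= n] by split; lia.
  by have [] := rainbow4_bound n3 k4n mn' cm kr; lia.
Qed.
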